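(* Let $H$ be a graph, and let $h \in V(H)$ be a vertex of $H$ that has no neighbor of degree one. If $G$ is a graph that does not contain $H$ as a minor, then $s(G) \leq 3|E(H - h)|$. If $G$ is also bipartite, then $s(G) \leq 2|E(H-h)|$. Here $s(G)$ is the surrounding cop number of $G$.
   Context: $H-h$ denotes the graph obtained from $H$ by deleting the vertex $h$, and $E(H-h)$ is its edge set. A graph $H$ is a minor of $G$ if it can be obtained from $G$ by deleting vertices, deleting edges and contracting edges. Surrounding Cops and Robbers is a perfect-information game played on a finite graph $G$ by two players. The first player controls a team of cops $C_1,\dots,C_m$; the second controls one robber. Initially, the first player places each cop on some vertex of $G$, and then the second player places the robber on some vertex of $G$. Then the two players alternate in taking turns. On the first player's turn, she moves each cop to an adjacent vertex or leaves it at its current vertex. On the second player's turn, he moves the robber to an adjacent vertex or leaves the robber at its current vertex. Two cops may occupy the same vertex, and a cop and the robber may occupy the same vertex, but the second player may not end a turn with the robber on the same vertex as a cop. The first player wins if at any point the robber occupies a vertex $r$ such that each neighbor of $r$ is occupied by a cop (the robber is surrounded). The second player wins by indefinitely preventing the first player from winning. The surrounding cop number $s(G)$ of a finite graph $G$ is the minimum $m$ such that the first player, with a team of $m$ cops, has a winning strategy on $G$.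
   Formalization: Adds that G is connected and that no vertex of H other than h is isolated; without these the claim fails (H = K_4 with G many disjoint triangles; H = a triangle through h plus 1000 isolated vertices with G = K_100). *)

(* Defs.v *)
From mathcomp Require Import all_boot.
From mathcomp Require Import boolp.

Set Implicit Arguments.
Unset Strict Implicit.
Unset Printing Implicit Defensive.

(** * Finite simple graphs *)

Record sgraph := SGraph {
  vertex :> finType;
  adj : rel vertex;
  adj_sym : symmetric adj;
  adj_irrefl : irreflexive adj }.

Notation "x -- y" := (adj x y) (at level 30).

Definition edges (G : sgraph) : {set {set G}} :=
  [set e : {set G} | [exists x : G, exists y : G, (x -- y) && (e == [set x; y])]].

Definition degree (G : sgraph) (x : G) : nat := #|[set y | x -- y]|.

Definition connected_graph (G : sgraph) : Prop :=
  forall x y : G, connect (@adj G) x y.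

Definition bipartite (G : sgraph) : Prop :=
  exists A : {set G}, forall x y : G, x -- y -> (x \in A) != (y \in A).

(** * Minors *)

Section DeleteVertex.
Variables (G : sgraph) (v : G).

Definition del_vertex_adj : rel {x : G | x != v} := fun x y => val x -- val y.

Fact del_vertex_sym : symmetric del_vertex_adj.
Proof. by move=> x y; apply: adj_sym. Qed.

Fact del_vertex_irrefl : irreflexive del_vertex_adj.
Proof. by move=> x; apply: adj_irrefl. Qed.

Definition del_vertex : sgraph := SGraph del_vertex_sym del_vertex_irrefl.
End DeleteVertex.

Section DeleteEdge.
Variables (G : sgraph) (u v : G).

Definition del_edge_adj : rel G :=
  fun x y => (x -- y) && ([set x; y] != [set u; v]).

Fact del_edge_sym : symmetric del_edge_adj.
Proof. by move=> x y; rewrite /del_edge_adj adj_sym setUC. Qed.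

Fact del_edge_irrefl : irreflexive del_edge_adj.
Proof. by move=> x; rewrite /del_edge_adj adj_irrefl. Qed.

Definition del_edge : sgraph := SGraph del_edge_sym del_edge_irrefl.
End DeleteEdge.

(** Contracting [u -- v]: [u] plays the role of the merged vertex and [v]
    disappears; loops and parallel edges are discarded. *)
Section ContractEdge.
Variables (G : sgraph) (u v : G).

Definition merge_vertex (x : G) : G := if x == v then u else x.

Definition contract_adj : rel {x : G | x != v} := fun x y =>
  (x != y) &&
  [exists a : G, exists b : G,
    [&& merge_vertex a == val x, merge_vertex b == val y & a -- b]].

Fact contract_sym : symmetric contract_adj.
Proof.
move=> x y; rewrite /contract_adj eq_sym; congr andb.
by apply/existsP/existsP => -[a /existsP[b /and3P[ax yb ab]]]; exists b;
  apply/existsP; exists a; rewrite ax yb adj_sym.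
Qed.

Fact contract_irrefl : irreflexive contract_adj.
Proof. by move=> x; rewrite /contract_adj eqxx. Qed.

Definition contract_edge : sgraph := SGraph contract_sym contract_irrefl.
End ContractEdge.

Definition isomorphic (G H : sgraph) : Prop :=
  exists2 f : G -> H, bijective f & forall x y : G, (f x -- f y) = (x -- y).

(** [has_minor G H]: [H] is a minor of [G]. *)
Inductive has_minor : sgraph -> sgraph -> Prop :=
| minor_iso (G H : sgraph) : isomorphic G H -> has_minor G H
| minor_del_vertex (G H : sgraph) (v : G) :
    has_minor (del_vertex v) H -> has_minor G H
| minor_del_edge (G H : sgraph) (u v : G) :
    u -- v -> has_minor (del_edge u v) H -> has_minor G H
| minor_contract_edge (G H : sgraph) (u v : G) :
    u -- v -> has_minor (contract_edge u v) H -> has_minor G H.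

(** * Surrounding Cops and Robbers *)

Section Game.
Variables (G : sgraph) (m : nat).

Definition cop_position := {ffun 'I_m -> G}.

Definition occupied (c : cop_position) (x : G) : bool := [exists i, c i == x].

Definition surrounded (c : cop_position) (r : G) : bool :=
  [forall y, (r -- y) ==> occupied c y].

Definition step (x y : G) : bool := (y == x) || (x -- y).

(** A strategy of the first player gives the positions of the cops as a function
    of the list of all robber positions so far, in chronological order; on the
    empty list it is the initial placement. *)
Definition cop_strategy := seq G -> cop_position.

Definition legal_strategy (S : cop_strategy) : Prop :=
  forall (s : seq G) (r : G) (i : 'I_m), step (S s i) (S (rcons s r) i).

(** Against the robber trajectory [rho], the positions of the cops after their
    [t]-th turn.  The order of play is thus [cops_at S rho 0], [rho 0],
    [cops_at S rho 1], [rho 1], ... *)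
Definition cops_at (S : cop_strategy) (rho : nat -> G) (t : nat) : cop_position :=
  S (mkseq rho t).

(** The initial placement [rho 0] is unrestricted. *)
Definition legal_trajectory (S : cop_strategy) (rho : nat -> G) : Prop :=
  forall t, step (rho t) (rho t.+1) /\
            ~~ occupied (cops_at S rho t.+1) (rho t.+1).

(** A robber who is not surrounded after a turn of the cops always has a legal
    move, so that plays in which he is never surrounded are infinite; this is why
    it is enough to range over infinite trajectories.  The two disjuncts are the
    situations just after the robber's and just after the cops' turn. *)
Definition winning_strategy (S : cop_strategy) : Prop :=
  legal_strategy S /\
  forall rho : nat -> G, legal_trajectory S rho ->
    exists t, surrounded (cops_at S rho t) (rho t) \/
              surrounded (cops_at S rho t.+1) (rho t).

Definition cops_win : Prop := exists S : cop_strategy, winning_strategy S.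

End Game.

Fact ex_cops_win (G : sgraph) : exists m, `[< cops_win G m >].
Proof.
exists #|G|; apply/asboolP.
exists (fun=> [ffun i => enum_val i]); split=> [s r i|rho _].
  by rewrite /step eqxx.
exists 0; left; apply/forallP => y; apply/implyP => _.
by apply/existsP; exists (enum_rank y); rewrite ffunE enum_rankK.
Qed.

Definition surrounding_cop_number (G : sgraph) : nat := ex_minn (ex_cops_win G).

(* Main.v *)
(** The cops confine the robber to a connected territory [R] and keep a partial
    model of [H - h] outside [R], in which every branch set touches [R].  Each edge
    of [H - h] has a team of cops, and the vertices outside [R] with a neighbour in
    [R] are all watched by the teams.  As long as some edge [xy] of [H - h] is not
    yet realised, its team is sent along a geodesic that goes from the branch set of
    [x] through [R] to the branch set of [y]; a team guards a geodesic [q] from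
    [q 0] by standing at [q (d - 1)], [q d], [q (d + 1)], where [d] is the distance
    of the robber from [q 0].  In a bipartite graph the robber enters [q] only at a
    vertex whose index differs from [d], so the cop at [q d] is not needed.  Each
    such step shrinks [R].  If all the edges were realised, contracting [R] to [h]
    would give [H] as a minor. *)

Require Import Defs.
From mathcomp Require Import all_boot.
From mathcomp Require Import boolp zify.

Set Implicit Arguments.
Unset Strict Implicit.
Unset Printing Implicit Defensive.

(** * The game *)

Section ForcedWin.
Variables (G : sgraph) (T : finType).

Definition taken (c : T -> G) (x : G) : Prop := exists t, c t = x.

(* Being surrounded need not be mentioned: a strategy that leaves the robber
   without a legal move after boundedly many turns admits no infinite legal
   trajectory. *)
Fixpoint trapped_in n (c : T -> G) (r : G) : Prop :=
  if n is n'.+1 then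
    forall r', step r r' -> ~ taken c r' ->
      exists2 c' : T -> G, (forall t, step (c t) (c' t)) & trapped_in n' c' r'
  else False.

Definition trapped (c : T -> G) (r : G) : Prop := exists n, trapped_in n c r.

Lemma trapped_in_mono m n c r : m <= n -> trapped_in m c r -> trapped_in n c r.
Proof.
elim: m n c r => [|m IHm] [|n] c r //= le_mn W r' rr' Nr'.
by have [c' cc' W'] := W r' rr' Nr'; exists c' => //; apply: IHm W'.
Qed.

(** Each answer of the robber comes with its own bound on the number of turns; [G] is finite, so a
    maximum bounds them all. Later arguments can thus go round by round without counting turns. *)
Lemma trapped_step c r :
    (forall r', step r r' -> ~ taken c r' ->
       exists2 c' : T -> G, (forall t, step (c t) (c' t)) & trapped c' r') ->
  trapped c r.
Proof.
move=> W.
have /fin_all_exists[n nP] : forall r' : G, exists n, step r r' -> ~ taken c r' ->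
    exists2 c' : T -> G, (forall t, step (c t) (c' t)) & trapped_in n c' r'.
  move=> r'; have [[rr' Nr']|nW] := pselect (step r r' /\ ~ taken c r').
    by have [c' cc' [n Wn]] := W r' rr' Nr'; exists n => _ _; exists c'.
  by exists 0 => rr' Nr'; case: nW.
exists (\max_(r' : G) n r').+1 => r' rr' Nr'.
have [c' cc' Wn] := nP r' rr' Nr'; exists c' => //.
by apply: trapped_in_mono Wn; apply: (leq_bigmax r').
Qed.

(** The cops stay put where no good move exists, because [legal_strategy] asks for legal moves after
    every list of robber positions, reachable or not. *)
Definition reply n (c : T -> G) (r r' : G) : T -> G :=
  if pselect (exists2 c' : T -> G, (forall t, step (c t) (c' t))
                                 & trapped_in n c' r') is left W
  then s2val (cid2 W) else c.

Lemma replyP n c r r' t : step (c t) (reply n c r r' t).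
Proof.
rewrite /reply; case: pselect => [W|_]; last by rewrite /step eqxx.
exact: (s2valP (cid2 W)).
Qed.

Lemma reply_trapped n c r r' :
    trapped_in n.+1 c r -> step r r' -> ~ taken c r' ->
  trapped_in n (reply n c r r') r'.
Proof.
move=> W rr' Nr'; rewrite /reply; case: pselect => [W'|[]]; last exact: W.
exact: (s2valP' (cid2 W')).
Qed.

(** The strategy replays the history, tracking the turns left, the cops and the last robber
    position. Along an infinite legal trajectory the counter would reach 0, where [trapped_in] is
    [False]. *)
Lemma trapped_cops_win m (c : T -> G) :
  #|T| = m -> (forall r, trapped c r) -> cops_win G m.
Proof.
move=> mT W; subst m.
have /fin_all_exists[N0 NP] := W.
pose N := \max_(r : G) N0 r.
have {}NP r : trapped_in N c r.
  by apply: trapped_in_mono (NP r); apply: (leq_bigmax r).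
(* The initial placement of the robber is only recorded and the cops pass, since [trapped] describes
   positions with the robber to move. *)
pose upd (st : nat * (T -> G) * option G) r' :=
  if st.2 is Some r then (st.1.1.-1, reply st.1.1.-1 st.1.2 r r', Some r')
  else (st.1, Some r').
pose state s := foldl upd (N, c, None) s.
pose S s : cop_position G #|T| := [ffun i => (state s).1.2 (enum_val i)].
exists S; split=> [s r i|rho legal].
  rewrite !ffunE /state foldl_rcons /upd.
  by case: (foldl _ _ s) => [[n b] [r0|]] /=; [exact: replyP | rewrite /step eqxx].
have run t : exists b, state (mkseq rho t.+1) = (N - t, b, Some (rho t)) /\
    trapped_in (N - t) b (rho t).
  elim: t => [|t [b [st_b Wb]]]; first by exists c; rewrite subn0.
  have [rr' Nr'] := legal t.
  have {}Nr' : ~ taken b (rho t.+1).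
    case=> z bz; move/negP: Nr'; apply; apply/existsP; exists (enum_rank z).
    by rewrite /cops_at ffunE st_b enum_rankK /= bz.
  case NtE: (N - t) Wb => [//|n] Wb.
  have -> : N - t.+1 = n by lia.
  exists (reply n b (rho t) (rho t.+1)); split; last exact: reply_trapped.
  by rewrite mkseqS /state foldl_rcons -/(state _) st_b NtE.
by have [b []] := run N; rewrite subnn.
Qed.

End ForcedWin.

(** * Minors from models *)

Definition within (G : sgraph) (A : {set G}) : rel G :=
  fun x y => [&& x -- y, x \in A & y \in A].

Definition connected_in (G : sgraph) (A : {set G}) : Prop :=
  forall x y, x \in A -> y \in A -> connect (within A) x y.

Lemma within_sym (G : sgraph) (A : {set G}) : symmetric (within A).
Proof. by move=> x y; rewrite /within adj_sym [(x \in A) && _]andbC. Qed.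

Lemma connect_map (T T' : finType) (e : rel T) (e' : rel T') (f : T -> T') :
    (forall a b, e a b -> connect e' (f a) (f b)) ->
  forall a b, connect e a b -> connect e' (f a) (f b).
Proof.
move=> ee' a b /connectP[p]; elim: p a => [|c p IHp] a /=; first by move=> _ ->.
by move=> /andP[/ee' ac cp] /(IHp _ cp); apply: connect_trans.
Qed.

Section MinorModel.
Variable H : sgraph.

Definition bag (G : sgraph) (phi : G -> option H) (x : H) : {set G} :=
  [set a | phi a == Some x].

Record minor_model (G : sgraph) (phi : G -> option H) : Prop := MinorModel {
  bag_nonempty : forall x, exists a, phi a = Some x;
  bag_connected : forall x, connected_in (bag phi x);
  bag_adj : forall x y, x -- y ->
    exists a b, [/\ phi a = Some x, phi b = Some y & a -- b] }.

(** Serves both the deletion of an unlabelled vertex and the contraction of an edge inside a bag.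
    The conditions concern labelled vertices only, as the bags consist of these. *)
Lemma minor_model_push (G G' : sgraph) (phi : G -> option H)
    (phi' : G' -> option H) (f : G -> G') :
    (forall a b, phi a != None -> phi b != None -> a -- b ->
       f a = f b \/ f a -- f b) ->
    (forall a, phi a != None -> phi' (f a) = phi a) ->
    (forall a', phi' a' != None -> exists2 a, f a = a' & phi a = phi' a') ->
  minor_model phi -> minor_model phi'.
Proof.
move=> f_adj f_phi f_surj [ne conn edge]; split=> [x|x a' b'|x y xy].
- by have [a ax] := ne x; exists (f a); rewrite f_phi ax.
- rewrite !inE => /eqP ax /eqP bx.
  have [|a faE aE] := f_surj a'; first by rewrite ax.
  have [|b fbE bE] := f_surj b'; first by rewrite bx.
  rewrite {}ax in aE; rewrite {}bx in bE; rewrite -faE -fbE {faE fbE}.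
  apply: connect_map (conn x a b _ _); rewrite ?inE ?aE ?bE // => {aE bE} c d.
  case/and3P=> cd; rewrite !inE => /eqP cE /eqP dE.
  have [|||-> //|fcd] := f_adj c d; rewrite ?cE ?dE //.
  by apply: connect1; rewrite /within fcd !inE !f_phi ?cE ?dE ?eqxx.
- have [a [b [ax bx ab]]] := edge x y xy; exists (f a), (f b).
  rewrite !f_phi ?ax ?bx; split=> //.
  have [|||fab|//] := f_adj a b; rewrite ?ax ?bx //.
  have: Some x = Some y by rewrite -ax -bx -(f_phi a) ?ax // fab f_phi ?bx.
  by case=> xy0; rewrite xy0 adj_irrefl in xy.
Qed.

(** Edges of [G] that [g] does not carry to edges of [H] are deleted one by one, until [g] is an
    isomorphism. *)
Lemma minor_of_bijection (G : sgraph) (g : G -> H) (k : H -> G) :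
    cancel g k -> cancel k g -> (forall x y, x -- y -> k x -- k y) ->
  has_minor G H.
Proof.
have [n] := ubnP #|[set p : G * G | p.1 -- p.2]|.
elim: n G g k => // n IHn G g k; rewrite ltnS => le_n gK kG edge.
have [/existsP[u /existsP[v /andP[uv guv]]]|full] :=
  boolP [exists u : G, exists v : G, (u -- v) && ~~ (g u -- g v)].
  apply: (minor_del_edge uv); apply: (IHn (del_edge u v) g k) => //.
    apply: leq_trans le_n; apply: proper_card; apply/properP; split.
      by apply/subsetP => -[a b]; rewrite !inE => /andP[].
    exists (u, v); rewrite !inE //=.
    by rewrite /del_edge_adj uv eqxx.
  move=> x y xy; rewrite /= /del_edge_adj edge //=.
  apply: contraNN guv => /eqP E.
  have : u \in [set k x; k y] by rewrite E !inE eqxx.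
  have : v \in [set k x; k y] by rewrite E !inE eqxx orbT.
  move: uv; rewrite !inE => uv /orP[]/eqP vE /orP[]/eqP uE; move: uv;
    rewrite uE vE !kG ?adj_irrefl // => _; by rewrite ?xy // adj_sym.
apply: minor_iso; exists g; first by exists k.
move=> u v; apply/idP/idP => [/edge|uv]; first by rewrite !gK.
apply: contraNT full => guv; apply/existsP; exists u; apply/existsP; exists v.
by rewrite uv.
Qed.

(** Induction on the order of [G]: an unlabelled vertex is deleted, an edge inside a bag is
    contracted. When neither exists, every connected bag is a single vertex and the labelling is a
    bijection. *)
Lemma minor_model_minor (G : sgraph) (phi : G -> option H) :
  minor_model phi -> has_minor G H.
Proof.
have [n] := ubnP #|G|; elim: n G phi => // n IHn G phi; rewrite ltnS => le_n M.
have card_sub (v : G) : #|{: {x : G | x != v}}| < n.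
  rewrite card_sig; apply: leq_trans le_n; apply: proper_card.
  by apply/properP; split; [apply/subsetP | exists v; rewrite !inE ?eqxx].
have [/existsP[v /eqP phi_v]|total] := boolP [exists v, phi v == None].
  apply: (@minor_del_vertex _ _ v); apply: (IHn (del_vertex v) (fun x => phi (val x))).
    exact: card_sub.
  (* The map [f] below needs a labelled vertex as default value; if there is none, [H] is empty. *)
  have [none|/existsNP[a0 phi_a0]] := pselect (forall a, phi a = None).
    have H0 (x : H) : False by have [a] := bag_nonempty M x; rewrite none.
    by split=> x; case: (H0 x).
  have ne_v a : phi a != None -> a != v.
    by apply: contraNneq => ->; apply/eqP.
  have a0v : a0 != v by apply/ne_v/eqP.
  pose f a : del_vertex v := insubd (Sub a0 a0v) a.
  have f_val a : phi a != None -> val (f a) = a.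
    by move=> /ne_v av; rewrite val_insubd av.
  apply: (minor_model_push (f := f)) M => [a b pa pb ab|a pa|a' pa'].
  - by right; rewrite /adj /= /del_vertex_adj !f_val.
  - by rewrite f_val.
  - by exists (val a') => //; apply: val_inj; rewrite f_val.
have [/existsP[u /existsP[v /andP[uv /eqP phi_uv]]]|inj] :=
  boolP [exists u : G, exists v : G, (u -- v) && (phi u == phi v)].
  have u_v : u != v by apply: contraTneq uv => ->; rewrite adj_irrefl.
  apply: (minor_contract_edge uv); apply: (IHn (contract_edge u v) (fun x => phi (val x))).
    exact: card_sub.
  pose f a : contract_edge u v := insubd (Sub u u_v) (merge_vertex u v a).
  have f_val a : val (f a) = merge_vertex u v a.
    by rewrite val_insubd /merge_vertex; case: (a =P v) => [_|/eqP->//]; rewrite u_v.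
  have phi_f a : phi (val (f a)) = phi a.
    by rewrite f_val /merge_vertex; case: (a =P v) => // ->.
  apply: (minor_model_push (f := f)) M => [a b _ _ ab|a _|a' pa'] //.
  - have [->|fab] := eqVneq (f a) (f b); [by left|right].
    rewrite /adj /= /contract_adj fab /=; apply/existsP; exists a.
    by apply/existsP; exists b; rewrite !f_val !eqxx.
  - have fK : f (val a') = a'.
      by apply: val_inj; rewrite f_val /merge_vertex (negPf (valP a')).
    by exists (val a').
have phiS a : exists x, phi a == Some x.
  case E: (phi a) => [x|]; first by exists x.
  by case/existsP: total; exists a; rewrite E.
pose g a := xchoose (phiS a).
have gP a : phi a = Some (g a) by apply/eqP/(xchooseP (phiS a)).
have kS x : exists a, phi a == Some x.
  by have [a ax] := bag_nonempty M x; exists a; apply/eqP.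
pose k x := xchoose (kS x).
have kK : cancel k g.
  by move=> x; have /eqP := xchooseP (kS x); rewrite gP => -[].
have g_inj : injective g.
  move=> a b gab; have /connectP[[|c p]] : connect (within (bag phi (g a))) a b.
  - by apply: (bag_connected M); rewrite inE gP // gab.
  - by move=> _ ->.
  rewrite /= => /andP[/and3P[ac]]; rewrite !inE => /eqP ax /eqP cx _ _.
  case/negP: inj; apply/existsP; exists a; apply/existsP; exists c.
  by rewrite ac ax cx eqxx.
have gK : cancel g k by move=> a; apply: g_inj; rewrite kK.
apply: (minor_of_bijection gK kK) => x y xy.
have [a [b [ax bx ab]]] := bag_adj M xy.
have kE c z : phi c = Some z -> k z = c.
  by rewrite gP => -[<-]; rewrite gK.
by rewrite (kE _ _ ax) (kE _ _ bx).
Qed.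

End MinorModel.

(** * Patrols *)

Definition boundary (G : sgraph) (R : {set G}) (v : G) : bool :=
  (v \notin R) && [exists r in R, r -- v].

Lemma boundaryP (G : sgraph) (R : {set G}) (v : G) :
  reflect (v \notin R /\ exists2 r, r \in R & r -- v) (boundary R v).
Proof.
by apply: (iffP andP) => -[vR /exists_inP].
Qed.

(** The shadow of a robber at [r] is the vertex of [route] with index [level r]. The team follows
    the shadow along [route], within the window of indices from [lo] to [hi]. *)
Record patrol (G : sgraph) := Patrol {
  route : nat -> G;
  level : G -> nat;
  lo : nat;
  hi : nat }.

Definition clamp a b i := maxn a (minn b i).

Section Patrols.
Variables (G : sgraph) (E K : finType) (off : K -> nat).
Implicit Types (R : {set G}) (g : patrol G) (s : E -> patrol G).

Definition patrol_ok g R : Prop :=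
  [/\ forall j, step (route g j) (route g j.+1),
      forall r r', r \in R -> r' \in R -> r -- r' -> level g r' <= (level g r).+1
    & lo g <= hi g].

Definition guards g R (v : G) : Prop :=
  exists j, [/\ lo g <= j <= hi g, route g j = v &
    forall r, r \in R -> r -- v -> exists k, level g r + off k = j.+1].

(* The index [level r + off k] is shifted by one, so that the offsets 0, 1, 2
   stand for a cop just behind, on, and just ahead of the shadow of the robber. *)
Definition positions s (r : G) (t : E * K) : G :=
  let g := s t.1 in
  route g (clamp (lo g) (hi g) (level g r + off t.2).-1).

Definition reassign s e g : E -> patrol G :=
  fun e' => if e' == e then g else s e'.

Definition stand (v : G) : patrol G := Patrol (fun=> v) (fun=> 1) 0 0.

Definition covered s R : Prop :=
  forall v, boundary R v -> exists e, guards (s e) R v.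

Lemma sub_guards g R R' v : R' \subset R -> guards g R v -> guards g R' v.
Proof.
move=> sR [j [jg gj H]]; exists j; split=> // r rR'; apply: H.
exact: (subsetP sR).
Qed.

Lemma sub_patrol_ok g R R' : R' \subset R -> patrol_ok g R -> patrol_ok g R'.
Proof.
move=> sR [w l h]; split=> // r r' rR r'R; apply: l; exact: (subsetP sR).
Qed.

Lemma stand_ok v R : patrol_ok (stand v) R.
Proof. by split=> // j; rewrite /step eqxx. Qed.

(** The index [j] of [v] lies in the window, so clamping does not move it, and the offset provided
    by [guards] puts a cop exactly on [v]. *)
Lemma guards_taken s e R r v :
  guards (s e) R v -> r \in R -> r -- v -> taken (positions s r) v.
Proof.
move=> [j [jb <- H]] rR rv; have [k kE] := H r rR rv.
by exists (e, k); rewrite /positions /= kE /=; congr route; rewrite /clamp; lia.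
Qed.

Lemma walk_step (w : nat -> G) i j :
    (forall j, step (w j) (w j.+1)) -> i <= j.+1 -> j <= i.+1 ->
  step (w i) (w j).
Proof.
move=> ww ij ji; have [->|[->|->]] : i = j.+1 \/ i = j \/ j = i.+1 by lia.
- by have := ww j; rewrite /step eq_sym adj_sym.
- by rewrite /step eqxx.
- exact: ww.
Qed.

Definition shifted g g' : Prop :=
  [/\ route g' = route g, level g' = level g, lo g <= (lo g').+1,
      lo g' <= (lo g).+1 & (hi g <= (hi g').+1) && (hi g' <= (hi g).+1)].

Lemma shifted_refl g : shifted g g.
Proof. by split=> //; lia. Qed.

(** One round: the robber cannot leave [R], as every boundary vertex next to him is occupied. Built
    from a maximum and a minimum, [clamp] changes by at most one when the level and both ends of the
    window do, so each cop has a legal move. *)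
Lemma trapped_shift s s' R r :
    (forall e, patrol_ok (s e) R) -> covered s R ->
    (forall e, shifted (s e) (s' e)) -> r \in R ->
    (forall r', r' \in R -> step r r' -> ~ taken (positions s r) r' ->
       trapped (positions s' r') r') ->
  trapped (positions s r) r.
Proof.
move=> ok cov sh rR W; apply: trapped_step => r' rr' Nr'.
have r'R : r' \in R.
  apply/negPn/negP => r'R.
  have {}rr' : r -- r'.
    by case/orP: rr' => [/eqP r'r|//]; rewrite r'r rR in r'R.
  have [|e ge] := cov r'; first by apply/boundaryP; split=> //; exists r.
  exact/Nr'/(guards_taken ge).
exists (positions s' r'); last exact: W.
move=> [e k]; rewrite /positions /=.
have [-> -> l1 l2 /andP[h1 h2]] := sh e; have [w lip _] := ok e.
have [L1 L2] : level (s e) r' <= (level (s e) r).+1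
            /\ level (s e) r <= (level (s e) r').+1.
  case/orP: rr' => [/eqP->|rr'] //; split; apply: lip => //.
  by rewrite adj_sym.
by apply: (walk_step w); rewrite /clamp; lia.
Qed.

Section Reassign.
Variables (s : E -> patrol G) (e : E) (R : {set G}).
Hypothesis s_ok : forall e', e' != e -> patrol_ok (s e') R.

(** [P] describes the boundary vertices left to the team of [e], which is about to move. *)
Definition covered_except (P : G -> Prop) : Prop :=
  forall v, boundary R v -> (exists2 e', e' != e & guards (s e') R v) \/ P v.

Lemma covered_reassign (P : G -> Prop) g :
    covered_except P -> (forall v, P v -> guards g R v) ->
  covered (reassign s e g) R.
Proof.
move=> cov Pg v /cov[[e' ne ge']|/Pg gv].
  by exists e'; rewrite /reassign (negPf ne).
by exists e; rewrite /reassign eqxx.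
Qed.

Lemma reassign_ok g : patrol_ok g R -> forall e', patrol_ok (reassign s e g e') R.
Proof.
move=> gok e'; rewrite /reassign; case: (eqVneq e' e) => // ne; exact: s_ok.
Qed.

Lemma reassign_shifted g g' :
  shifted g g' -> forall e', shifted (reassign s e g e') (reassign s e g' e').
Proof.
by move=> gg' e'; rewrite /reassign; case: eqP => // _; apply: shifted_refl.
Qed.

Lemma positions_reassign g g' r :
    (forall k, route g (clamp (lo g) (hi g) (level g r + off k).-1)
             = route g' (clamp (lo g') (hi g') (level g' r + off k).-1)) ->
  positions (reassign s e g) r = positions (reassign s e g') r.
Proof.
move=> gg'; apply: funext => -[e' k]; rewrite /positions /reassign /=.
by case: eqP.
Qed.

(** Each round brings the ends of the window one step closer to [i]. A vertex guarded with the
    window reduced to [i] is guarded with every larger one, so the team gathers on [w i] without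
    giving up [P]. *)
Lemma trapped_tighten (P : G -> Prop) w d a b i :
    patrol_ok (Patrol w d a b) R -> a <= i <= b ->
    covered_except P -> (forall v, P v -> guards (Patrol w d i i) R v) ->
    (forall r, r \in R -> trapped (positions (reassign s e (stand (w i))) r) r) ->
  forall r, r \in R -> trapped (positions (reassign s e (Patrol w d a b)) r) r.
Proof.
move=> ok ai cov Pg W.
have [n le_n] := ubnP (b - a); elim: n a b ok ai le_n => // n IHn a b ok ai le_n r rR.
have ok' a' b' : a' <= b' -> patrol_ok (Patrol w d a' b') R by case: ok.
have cov' : covered (reassign s e (Patrol w d a b)) R.
  apply: covered_reassign cov _ => v /Pg[j /= [ji wj gj]].
  by exists j; split=> //=; lia.
have [ab|ab] := eqVneq a b.
  have -> : positions (reassign s e (Patrol w d a b)) r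
          = positions (reassign s e (stand (w i))) r.
    by apply: positions_reassign => k /=; congr w; rewrite /clamp; lia.
  exact: W.
pose a' := minn a.+1 i; pose b' := maxn b.-1 i.
apply: (trapped_shift (s' := reassign s e (Patrol w d a' b'))) cov' _ rR _.
- exact: reassign_ok.
- by apply: reassign_shifted; split=> //=; rewrite /a' /b'; lia.
- move=> r' r'R _ _; apply: IHn => //; rewrite /a' /b'; try lia.
  by apply: ok'; lia.
Qed.

(** A team with nothing to guard walks along [w] as a window of one index that advances each
    round. *)
Lemma trapped_walk w t :
    (forall j, step (w j) (w j.+1)) -> covered_except (fun=> False) ->
    (forall r, r \in R -> trapped (positions (reassign s e (stand (w t))) r) r) ->
  forall r, r \in R -> trapped (positions (reassign s e (stand (w 0))) r) r.
Proof.
move=> ww cov; elim: t => [//|t IHt] W; apply: IHt => r rR.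
pose g i := Patrol w (fun=> 1) i i.
have gE i x : positions (reassign s e (stand (w i))) x
            = positions (reassign s e (g i)) x.
  by apply: positions_reassign => k /=; congr w; rewrite /clamp; lia.
rewrite gE.
apply: (trapped_shift (s' := reassign s e (g t.+1))) rR _.
- by apply: reassign_ok; split.
- by apply: covered_reassign cov _.
- by apply: reassign_shifted; split=> //=; lia.
- by move=> r' r'R _ _; rewrite -gE; apply: W.
Qed.

Lemma path_walk (x : G) p : path (@adj G) x p ->
  exists w : nat -> G, [/\ forall j, step (w j) (w j.+1), w 0 = x
    & forall j, j <= size p -> w j = nth x (x :: p) j] .
Proof.
(* With [last x p] as default value, the walk rests forever at the end of the path. *)
move=> xp; exists (fun j => nth (last x p) (x :: p) j); split=> // [j|j jp].
  case: (ltnP j (size p)) => jp; last first.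
    rewrite /step; apply/orP; left; apply/eqP.
    rewrite nth_default //; case: (ltngtP j (size p)) jp => // [jp|->] _.
      by rewrite nth_default.
    by rewrite nth_last.
  have /(pathP (last x p))/(_ j jp) := xp; rewrite /step => ->; exact: orbT.
exact: set_nth_default.
Qed.

(** A team that has at most [v] to guard can gather on [v]. If it guards [v], its window closes on
    the index of [v]; otherwise it is free, so it gathers at the lower end of its window and walks
    to [v]. *)
Lemma trapped_relocate v :
    connected_graph G -> patrol_ok (s e) R ->
    covered_except (fun u => u = v /\ guards (s e) R v) ->
    (forall r, r \in R -> trapped (positions (reassign s e (stand v)) r) r) ->
  forall r, r \in R -> trapped (positions s r) r.
Proof.
move=> conn ok cov W r rR.
have -> : positions s r = positions (reassign s e (s e)) r.
  apply: funext => -[e' k]; rewrite /positions /reassign /=.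
  by case: eqP => // ->.
case gE: (s e) => [w d a b]; rewrite gE in ok cov.
have [[j [/= ab wj Hj]]|ng] := pselect (guards (Patrol w d a b) R v).
  apply: (trapped_tighten ok ab cov) => // [u [-> _]|].
    by exists j; split=> //=; lia.
  by rewrite wj.
have {}cov : covered_except (fun=> False).
  by move=> u /cov[?|[_ /ng]]; [left|].
have [ww _ /= ab] := ok.
apply: (@trapped_tighten (fun=> False) w d a b a) => //; first lia.
have /connectP[p] := conn (w a) v.
move=> /path_walk[w' [w'w <- w'p]] vp; apply: (trapped_walk (t := size p)) => //.
by rewrite w'p // -[size p]/(size (w' 0 :: p)).-1 nth_last /= -vp.
Qed.

Hypothesis off2 : exists k, off k = 2.

(* The front of the patrol advances one vertex per round; [level (q h) = h]
   and the offset 2 put a cop on [q h] as soon as it is the front, so a robber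
   who stands there has to leave, and he cannot step on [q 0, ..., q h]. *)
Lemma trapped_advance q d n :
    patrol_ok (Patrol q d 0 n) R ->
    covered_except (fun v => v = q 0) ->
    (forall r j, r \in R -> j <= n -> r -- q j -> exists k, d r + off k = j.+1) ->
    (forall j, j <= n -> q j \in R -> d (q j) = j) ->
    (forall r, r \in R -> (forall j, j <= n -> r != q j) ->
       trapped (positions (reassign s e (Patrol q d 0 n)) r) r) ->
  forall r, r \in R -> trapped (positions (reassign s e (stand (q 0))) r) r.
Proof.
move=> [qw lip _] cov adj_q dq W r0 r0R.
have -> : positions (reassign s e (stand (q 0))) r0
        = positions (reassign s e (Patrol q d 0 0)) r0.
  by apply: positions_reassign => k /=; congr q; rewrite /clamp; lia.
pose g h := reassign s e (Patrol q d 0 h).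
have ok h : patrol_ok (Patrol q d 0 h) R by split.
have cov' h : h <= n -> covered (g h) R.
  move=> hn; apply: covered_reassign cov _ => _ ->; exists 0; split=> //= r rR rq.
  exact: adj_q.
have front h r r' : h <= n -> r \in R -> (forall j, j < h -> r != q j) ->
    r' \in R -> step r r' -> ~ taken (positions (g h) r) r' ->
  forall j, j <= h -> r' != q j.
  move=> hn rR rq r'R rr' Nr' j jh; apply/eqP => r'q; apply: Nr'.
  have [r'r|rr''] := orP rr'.
    have jhE : j = h.
      case: (ltngtP j h) jh => // jh _.
      by have := rq j jh; rewrite -(eqP r'r) r'q eqxx.
    (* The cop ahead aims at index [h.+1] and is clamped back to the front [h]. *)
    have [k kE] := off2; exists (e, k); rewrite /positions /g /reassign eqxx /= kE.
    have -> : d r = h by rewrite -(eqP r'r) r'q dq -?r'q ?jhE.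
    by rewrite r'q jhE; congr q; rewrite /clamp; lia.
  rewrite r'q in rr''; have [|k kE] := adj_q r j rR _ rr''; first lia.
  exists (e, k); rewrite /positions /g /reassign eqxx /= kE r'q; congr q.
  by rewrite /clamp; lia.
suff H m h r : m + h = n -> r \in R -> (forall j, j < h -> r != q j) ->
    trapped (positions (g h) r) r.
  by apply: (H n 0) => //; rewrite addn0.
elim: m h r => [|m IHm] h r mh rR rq; have hn : h <= n by lia.
(* The front has reached the end; one more round with the same window drives the robber off
   [q n]. *)
- apply: (trapped_shift (s' := g h) _ (cov' h hn) _ rR).
  + exact: reassign_ok.
  + by apply: reassign_shifted; exact: shifted_refl.
  + move=> r' r'R rr' Nr'; rewrite /g; have -> : h = n by lia.
    by apply: W => // j jn; apply: (front h r) => //; lia.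
- apply: (trapped_shift (s' := g h.+1) _ (cov' h hn) _ rR).
  + exact: reassign_ok.
  + by apply: reassign_shifted; split=> //=; lia.
  + move=> r' r'R rr' Nr'; apply: IHm => //; first lia.
    exact: (front h r).
Qed.

End Reassign.
End Patrols.

(** * Geodesics in a territory *)

Lemma bipartite_walk (G : sgraph) (A : {set G}) x p :
    (forall x y : G, x -- y -> (x \in A) != (y \in A)) -> path (@adj G) x p ->
  (last x p \in A) = (x \in A) (+) odd (size p).
Proof.
move=> bip; elim: p x => [|y p IHp] x /=; first by rewrite addbF.
case/andP=> /bip xy /IHp ->; move: xy.
by case: (x \in A); case: (y \in A); case: odd.
Qed.

Section Geodesic.
Variables (G : sgraph) (K : finType) (off : K -> nat).
Hypotheses (off0 : exists k, off k = 0) (off2 : exists k, off k = 2).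
Hypothesis off1 : bipartite G \/ exists k, off k = 1.

(** [d] is the distance from [c] along walks that stay in [R] after [c]. A robber next to the vertex
    of index [j] has level [j.+1], [j.-1] or [j], answered by the offsets 0, 2 and 1; in a bipartite
    graph parity excludes level [j]. *)
Lemma geodesic (R : {set G}) (c a b : G) :
    connected_in R -> c \notin R -> a \in R -> c -- a -> b \in R ->
  exists (q : seq G) (d : G -> nat),
    [/\ [/\ path (@adj G) c q, {subset q <= R}, uniq q & last c q = b],
        forall r r', r \in R -> r' \in R -> r -- r' -> d r' <= (d r).+1,
        forall j, j <= size q -> d (nth c (c :: q) j) = j
      & forall r j, r \in R -> j <= size q -> r -- nth c (c :: q) j ->
          exists k, d r + off k = j.+1].
Proof.
move=> conn cR aR ca bR.
pose e : rel G := fun x y => (x -- y) && (y \in R).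
pose walk v n := exists p, [/\ path e c p, last c p = v & size p = n].
(* The default 0 falls only on vertices that no such walk reaches, hence never on a vertex of
   [R]. *)
pose d v := if pselect (exists n, `[<walk v n>]) is left W then ex_minn W else 0.
have dP v n : walk v n -> walk v (d v) /\ d v <= n.
  move=> vn; rewrite /d; case: pselect => [W|[]]; last by exists n; apply/asboolP.
  case: ex_minnP => m /asboolP vm min_m; split=> //.
  exact/min_m/asboolP.
have walkS v w n : walk v n -> v -- w -> w \in R -> walk w n.+1.
  case=> p [cp <- <-] vw wR; exists (rcons p w); split; rewrite ?last_rcons ?size_rcons //.
  by rewrite rcons_path cp /e vw.
have reach v : v \in R -> exists n, walk v n.
  move=> vR; have /connectP[p ap ->] := conn a v aR vR.
  exists (size p).+1, (a :: p); split=> //=; rewrite /e ca aR /=.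
  by apply: sub_path ap => x y /and3P[-> _ ->].
have [n0 /dP[[q [eq lq sq]] _]] := reach b bR.
have qR : {subset q <= R}.
  move=> x xq; have /(nthP c)[i iq <-] := xq.
  by have /(pathP c)/(_ i iq)/andP[] := eq.
have nthR j : j <= size q -> nth c (c :: q) j = c \/ nth c (c :: q) j \in R.
  by case: j => [|j] jq; [left | right; apply/qR/mem_nth].
have walk_nth j : j <= size q -> walk (nth c (c :: q) j) j.
  move=> jq; exists (take j q); split; rewrite ?size_takel //.
    exact: take_path.
  case: j jq => [|j] jq; first by rewrite take0.
  rewrite (take_nth c) // last_rcons //.
have d_nth j : j <= size q -> d (nth c (c :: q) j) = j.
  move=> jq; have [[p [ep lp sp]] le_j] := dP _ _ (walk_nth j jq).
  (* A shorter walk to the vertex of index [j], followed by the rest of [q], would be a shorter walk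
     to [b]. *)
  have : d b <= size (p ++ drop j q).
    apply: (dP b _ _).2; exists (p ++ drop j q); split=> //.
      rewrite cat_path ep lp /=; case: j jq {le_j ep lp sp} => [|j] jq /=.
        by rewrite drop0.
      have := eq; rewrite -{1}(cat_take_drop j.+1 q) cat_path => /andP[_].
      by rewrite (take_nth c) // last_rcons.
    rewrite last_cat lp; case: j jq {le_j ep lp sp} => [|j] jq /=.
      by rewrite drop0.
    rewrite -lq -{3}(cat_take_drop j.+1 q) last_cat.
    by rewrite (take_nth c) // last_rcons.
  rewrite size_cat size_drop -sq sp; lia.
exists q, d; split=> //.
- split=> //; first by apply: sub_path eq => x y /andP[].
  have : uniq (map d (c :: q)); last by move/map_uniq => /andP[].
  have -> : map d (c :: q) = iota 0 (size q).+1; last exact: iota_uniq.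
  apply: (@eq_from_nth _ 0); rewrite size_map ?size_iota // => j jq.
  by rewrite (nth_map c) // nth_iota // add0n d_nth.
- move=> r r' rR r'R rr'; have [n /dP[rd _]] := reach r rR.
  exact: (dP _ _ (walkS _ _ _ rd rr' r'R)).2.
- move=> r j rR jq rj; have [n /dP[rd _]] := reach r rR.
  have jr : d r <= j.+1.
    by apply: (dP _ _ (walkS _ _ _ (walk_nth j jq) _ rR)).2; rewrite adj_sym.
  have rj' : j <= (d r).+1.
    rewrite -{1}(d_nth j jq); have [jc|jR] := nthR j jq.
      by have := d_nth j jq; rewrite jc -[X in d X]/(nth c (c :: q) 0) d_nth // => <-.
    exact: (dP _ _ (walkS _ _ _ rd rj jR)).2.
  have [drj|ndrj] := eqVneq (d r) j; last first.
    have [dr|dr] : d r = j.+1 \/ d r = j.-1 /\ 0 < j by lia.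
      by have [k k0] := off0; exists k; lia.
    by have [k k2] := off2; exists k; lia.
  case: off1 => [[A bip]|[k k1]]; last by exists k; lia.
  have side v m : walk v m -> (v \in A) = (c \in A) (+) odd m.
    move=> [p [ep <- <-]]; apply: bipartite_walk => //.
    by apply: sub_path ep => x y /andP[].
  by have := bip _ _ rj; rewrite (side _ _ rd) (side _ _ (walk_nth j jq)) drj eqxx.
Qed.

End Geodesic.

(** * Partial models *)

Lemma connected_from (G : sgraph) (A : {set G}) u :
  (forall z, z \in A -> connect (within A) u z) -> connected_in A.
Proof.
move=> uA x y xA yA; apply: connect_trans (uA y yA).
by rewrite (sym_connect_sym (@within_sym _ A)); apply: uA.
Qed.

Lemma path_within (G : sgraph) (A : {set G}) u p z :
  path (@adj G) u p -> u \in A -> {subset p <= A} -> z \in p ->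
  connect (within A) u z.
Proof.
elim: p u => [//|v p IHp] u /= /andP[uv vp] uA pA zp.
have vA : v \in A by apply: pA; rewrite mem_head.
have uv' : connect (within A) u v by apply: connect1; rewrite /within uv uA.
move: zp; rewrite inE => /orP[/eqP->//|zp].
apply: connect_trans uv' (IHp v vp vA _ zp) => w wp.
by apply: pA; rewrite inE wp orbT.
Qed.

Lemma connected_within_sub (G : sgraph) (A B : {set G}) x y :
  A \subset B -> connect (within A) x y -> connect (within B) x y.
Proof.
move=> AB; apply: connect_sub => a b /and3P[ab aA bA]; apply: connect1.
by rewrite /within ab !(subsetP AB).
Qed.

Section Territory.
Variables (G : sgraph) (V E K : finType) (off : K -> nat).
Variable inc : E -> V -> V -> bool.
Hypothesis inc_sym : forall e x y, inc e x y = inc e y x.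
Hypothesis inc_uniq : forall e x y x' y', inc e x y -> inc e x' y' ->
  (x' = x /\ y' = y) \/ (x' = y /\ y' = x).

Implicit Types (lam : G -> option (V + E)) (R : {set G}) (c : V -> G).

Definition core lam x : {set G} := [set v | lam v == Some (inl x)].

(** [f] is the interior of a connection between two branch sets; when empty, they are joined by an
    edge. *)
Definition linked lam x (f : seq G) y : Prop :=
  exists u v, [/\ lam u = Some (inl x), lam v = Some (inl y)
                & path (@adj G) u (rcons f v)].

Lemma linked_rev lam x f y : linked lam x f y -> linked lam y (rev f) x.
Proof.
move=> [u [v [ux vy uv]]]; exists v, u; split=> //.
have := rev_path (@adj G) u (rcons f v).
rewrite last_rcons belast_rcons rev_cons => ->.
by rewrite (eq_path (e' := @adj G)) // => a b; rewrite adj_sym.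
Qed.

Definition flex_path lam e x y : Prop :=
  exists f, [/\ uniq f, forall v, (v \in f) = (lam v == Some (inr e))
              & linked lam x f y].

Lemma flex_path_sym lam e x y : flex_path lam e x y -> flex_path lam e y x.
Proof.
move=> [f [uf fE xfy]]; exists (rev f); split; rewrite ?rev_uniq //.
  by move=> v; rewrite mem_rev.
exact: linked_rev.
Qed.

(* A partial model of [H - h] outside the territory [R] of the robber.  A vertex
   labelled [inl x] belongs to the branch set of [x], one labelled [inr e] to
   the path that joins the branch sets of the ends of [e] and may still be
   given to either of them.  The point is that each branch set has at most one
   vertex, [c x], on the boundary of [R]: if a branch set loses contact with
   [R], then the patrols of its edges have at most one vertex each left to
   guard, and from a single vertex a patrol can start along any geodesic. *)
Record partial_model (R : {set G}) (s : E -> patrol G) (U : {set V})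
    (D : {set E}) lam c (gd : V -> E) : Prop := PartialModel {
  pm_conn : connected_in R;
  pm_patrol : forall e, patrol_ok (s e) R;
  pm_free : forall v, v \in R -> lam v = None;
  pm_labU : forall v x, lam v = Some (inl x) -> x \in U;
  pm_labD : forall v e, lam v = Some (inr e) -> e \in D;
  pm_contact : forall x, x \in U -> lam (c x) = Some (inl x);
  pm_core : forall x, connected_in (core lam x);
  pm_DU : forall e x y, e \in D -> inc e x y -> x \in U;
  pm_flex : forall e x y, e \in D -> inc e x y -> flex_path lam e x y;
  pm_bound : forall v, boundary R v -> lam v <> None;
  pm_bound_core : forall v x, boundary R v -> lam v = Some (inl x) -> v = c x;
  pm_guard_inc : forall x, x \in U -> exists y, inc (gd x) x y;
  pm_guard : forall x, x \in U -> boundary R (c x) ->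
    guards off (s (gd x)) R (c x);
  pm_guard_one : forall e x y, e \notin D -> inc e x y -> x \in U -> y \in U ->
    gd x = e -> gd y <> e;
  pm_guard_flex : forall v e, boundary R v -> lam v = Some (inr e) ->
    guards off (s e) R v }.

Definition update (A : eqType) B (f : A -> B) a b : A -> B :=
  fun z => if z == a then b else f z.

Lemma update_eq (A : eqType) B (f : A -> B) a b : update f a b a = b.
Proof. by rewrite /update eqxx. Qed.

Lemma update_neq (A : eqType) B (f : A -> B) a b z : z != a -> update f a b z = f z.
Proof. by rewrite /update => /negPf ->. Qed.

(** The branch set of [x] has lost contact with [R], but the path of [e] still has a vertex on the
    boundary. The path is given to [x] up to its first boundary vertex [q], which becomes the only
    contact of [x] and is already guarded by the team of [e]. *)
Lemma pm_claim R s U D lam c gd x e y w :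
    partial_model R s U D lam c gd ->
    x \in U -> ~~ boundary R (c x) -> e \in D -> inc e x y ->
    boundary R w -> lam w = Some (inr e) ->
  exists lam' q, boundary R q /\
    partial_model R s U D lam' (update c x q) (update gd x e).
Proof.
move=> M xU ncx eD exy bw we.
have [f [uf fE [u [v [ux vy uv]]]]] := pm_flex M eD exy.
have : has (boundary R) f by apply/hasP; exists w => //; rewrite fE we.
move=> hf; case: (split_find hf) uf fE uv => q s1 s2 bq nbs1 {hf}.
set f1 := rcons s1 q => uf fE uv.
pose lam' z := if z \in f1 then Some (inl x) else lam z.
have f1e z : z \in f1 -> lam z = Some (inr e).
  by move=> zf; apply/eqP; rewrite -fE mem_cat zf.
have lam'E z i : lam z = Some (inl i) -> lam' z = Some (inl i).
  by rewrite /lam'; case: ifP => // /f1e ->.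
have lam'x z i : i != x -> lam' z = Some (inl i) -> lam z = Some (inl i).
  by move=> ix; rewrite /lam'; case: ifP => // _ [xi]; rewrite xi eqxx in ix.
have lam'r z i : lam' z = Some (inr i) -> lam z = Some (inr i).
  by rewrite /lam'; case: ifP.
have link' a g b : linked lam a g b -> linked lam' a g b.
  by case=> [a' [b' [/lam'E aa /lam'E bb ab]]]; exists a', b'.
have qf1 : q \in f1 by rewrite mem_rcons mem_head.
have eflex : flex_path lam' e x y.
  exists s2; split=> [|z|].
  - by move: uf; rewrite cat_uniq => /and3P[].
  - rewrite /lam'; case: ifP => [zf1|zf1]; last by rewrite -fE mem_cat zf1.
    apply: contraTF uf => zs2; rewrite cat_uniq negb_and orbC.
    by rewrite negb_and negbK; apply/orP; left; apply/orP; left; apply/hasP; exists z.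
  - exists q, v; split=> //; [by rewrite /lam' qf1|exact: lam'E|].
    by move: uv; rewrite rcons_cat cat_path last_rcons => /andP[].
exists lam', q; split=> //; split.
- exact: (pm_conn M).
- exact: (pm_patrol M).
- move=> z zR; rewrite /lam'; case: ifP => [/f1e|_]; last exact: (pm_free M).
  by rewrite (pm_free M zR).
- move=> z i; rewrite /lam'; case: ifP => [_ [<-]//|_]; exact: (pm_labU M).
- move=> z i /lam'r; exact: (pm_labD M).
- move=> i iU; have [->|ix] := eqVneq i x.
    by rewrite update_eq /lam' qf1.
  by rewrite update_neq //; apply/lam'E/(pm_contact M).
- move=> i; have [->|ix] := eqVneq i x; last first.
    suff -> : core lam' i = core lam i by exact: (pm_core M).
    apply/setP => z; rewrite !inE; apply/eqP/eqP => [/lam'x|/lam'E] //; exact.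
  have sub : core lam x \subset core lam' x.
    by apply/subsetP => z; rewrite !inE => /eqP/lam'E ->.
  have uc : u \in core lam x by rewrite inE ux.
  apply: (connected_from (u := u)) => z; rewrite inE /lam'.
  case: ifP => [zf _|_ /eqP zx].
    apply: path_within zf; last by move=> a af; rewrite inE /lam' af.
      by move: uv; rewrite rcons_cat cat_path => /andP[].
    exact: (subsetP sub).
  apply: connected_within_sub sub _; apply: (pm_core M) => //; by rewrite inE zx.
- exact: (pm_DU M).
- move=> i a b iD iab; have [ie|ie] := eqVneq i e.
    rewrite ie in iab *.
    by have [[-> ->]|[-> ->]] := inc_uniq exy iab => //; apply: flex_path_sym.
  have [g [ug gE /link' lg]] := pm_flex M iD iab; exists g; split=> // z.
  rewrite gE /lam'; case: ifP => // /f1e ->.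
  by apply: contraNF ie => /eqP[->].
- move=> z bz; rewrite /lam'; case: ifP => // _; exact: (pm_bound M bz).
- move=> z i bz; have [->|ix] := eqVneq i x; last first.
    by move/lam'x => /(_ ix); rewrite update_neq //; exact: (pm_bound_core M bz).
  rewrite update_eq /lam'; case: ifP => [|_ zx].
    rewrite mem_rcons inE => /orP[/eqP//|zs1].
    by case/hasP: nbs1; exists z.
  by case/negP: ncx; rewrite -(pm_bound_core M bz zx).
- move=> i iU; have [->|ix] := eqVneq i x.
    by rewrite update_eq; exists y.
  by rewrite update_neq //; exact: (pm_guard_inc M iU).
- move=> i iU; have [->|ix] := eqVneq i x.
    rewrite !update_eq => bq'; exact: (pm_guard_flex M bq' (f1e _ qf1)).
  by rewrite !update_neq //; exact: (pm_guard M iU).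
(* This clause concerns edges outside [D], so the new value [e] of the guard of [x] does not affect
   it. *)
- move=> i a b iD iab aU bU; have ie : e != i by apply: contraNneq iD => <-.
  have [->|ax] := eqVneq a x; first by rewrite update_eq => /eqP; rewrite (negPf ie).
  have [->|bx] := eqVneq b x.
    by rewrite update_eq => _ /eqP; rewrite (negPf ie).
  by rewrite !update_neq //; exact: (pm_guard_one M iD iab aU bU).
- move=> z i bz /lam'r; exact: (pm_guard_flex M bz).
Qed.

(** When neither the branch set of [x] nor a path at [x] touches the boundary, [x] and its edges can
    be forgotten: every label on the boundary survives. *)
Lemma pm_drop R s U D lam c gd x :
    partial_model R s U D lam c gd -> ~~ boundary R (c x) ->
    (forall e y v, inc e x y -> boundary R v -> lam v <> Some (inr e)) ->
  exists lam', partial_model R s (U :\ x) (D :\: [set e | [exists y, inc e x y]])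
    lam' c gd.
Proof.
move=> M ncx nf; pose touch e := [exists y, inc e x y].
pose lam' v := match lam v with
  | Some (inl z) => if z == x then None else lam v
  | Some (inr e) => if touch e then None else lam v
  | None => None end.
have lam'V v z : lam' v = Some (inl z) <-> z != x /\ lam v = Some (inl z).
  rewrite /lam'; case lv: (lam v) => [[i|i]|]; last by split=> // -[].
    case: eqVneq => [->|ix]; last by split=> [[<-]|[]].
    by split=> // -[zx [xz]]; rewrite xz eqxx in zx.
  by case: ifP => _; split=> // -[].
have lam'E v e : lam' v = Some (inr e) <-> ~~ touch e /\ lam v = Some (inr e).
  rewrite /lam'; case lv: (lam v) => [[i|i]|]; last by split=> // -[].
    by case: eqP => _; split=> // -[].
  case: ifP => ti; last by split=> [[<-]|[]]; rewrite ?ti.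
  by split=> // -[te [ie]]; rewrite -ie ti in te.
have lam'b v : boundary R v -> lam' v = lam v.
  move=> bv; rewrite /lam'; case lv: (lam v) => [[i|i]|] //.
    case: eqP => // ix; case/negP: ncx; rewrite -ix -(pm_bound_core M bv) //.
  by case: ifP => // /existsP[y iy]; case: (nf _ _ _ iy bv).
have ntouch e a b : ~~ touch e -> inc e a b -> (a != x) /\ (b != x).
  move=> te eab; split; apply: contraNneq te => abx.
    by apply/existsP; exists b; rewrite -abx.
  by apply/existsP; exists a; rewrite -abx inc_sym.
exists lam'; split.
- exact: (pm_conn M).
- exact: (pm_patrol M).
- by move=> v vR; rewrite /lam' (pm_free M).
- by move=> v z /lam'V[zx /(pm_labU M) zU]; rewrite !inE zx.
- by move=> v e /lam'E[te /(pm_labD M) eD]; rewrite !inE te.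
- by move=> z; rewrite !inE => /andP[zx zU]; apply/lam'V; split=> //; exact: (pm_contact M zU).
- move=> z; have [->|zx] := eqVneq z x.
    by move=> a b; rewrite inE => /eqP/lam'V[]; rewrite eqxx.
  suff -> : core lam' z = core lam z by exact: (pm_core M).
  by apply/setP => v; rewrite !inE; apply/eqP/eqP => [/lam'V[]|vz] //; apply/lam'V.
- move=> e a b; rewrite !inE => /andP[te eD] eab.
  by have [ax _] := ntouch _ _ _ te eab; rewrite ax (pm_DU M eD eab).
- move=> e a b; rewrite !inE => /andP[te eD] eab.
  have [ax bx] := ntouch _ _ _ te eab.
  have [f [uf fE [u [v [ua vb uv]]]]] := pm_flex M eD eab.
  exists f; split=> [//|w|]; last by exists u, v; split=> //; apply/lam'V.
  by rewrite fE; apply/eqP/eqP => [we|/lam'E[]] //; apply/lam'E.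
- by move=> v bv; rewrite lam'b //; exact: (pm_bound M bv).
- by move=> v z bv; rewrite lam'b //; exact: (pm_bound_core M bv).
- by move=> z; rewrite !inE => /andP[_]; exact: (pm_guard_inc M).
- by move=> z; rewrite !inE => /andP[_]; exact: (pm_guard M).
- move=> e a b eD eab; rewrite !inE => /andP[ax aU] /andP[bx bU].
  apply: (pm_guard_one M _ eab aU bU); apply: contraNN eD => eD.
  (* An edge that has just left [D] touches [x], so its ends cannot both remain. *)
  rewrite !inE eD andbT; apply/negP => /existsP[z exz].
  have [[az _]|[_ bz]] := inc_uniq exz eab.
    by rewrite az eqxx in ax.
  by rewrite bz eqxx in bx.
- by move=> v e bv; rewrite lam'b //; exact: (pm_guard_flex M bv).
Qed.

(** Every claim or drop lowers the number of branch sets without contact. The territory and the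
    patrols stay the same, so the cops need not move. *)
Lemma pm_cleanup R s U D lam c gd :
    partial_model R s U D lam c gd ->
  exists U' D' lam' c' gd', partial_model R s U' D' lam' c' gd' /\
    forall x, x \in U' -> boundary R (c' x).
Proof.
have [n] := ubnP #|[set x in U | ~~ boundary R (c x)]|.
elim: n U D lam c gd => // n IHn U D lam c gd; rewrite ltnS => le_n M.
have [/exists_inP[x xU ncx]|clean] := boolP [exists x in U, ~~ boundary R (c x)];
  last first.
  exists U, D, lam, c, gd; split=> // x xU.
  by apply: contraNT clean => ncx; apply/exists_inP; exists x.
have [[e [y [w [eD exy bw we]]]]|nf] := pselect (exists e y w,
    [/\ e \in D, inc e x y, boundary R w & lam w = Some (inr e)]).
  have [lam' [q [bq M']]] := pm_claim M xU ncx eD exy bw we.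
  apply: IHn M'; apply: leq_trans le_n; apply: proper_card; apply/properP; split.
    apply/subsetP => z; rewrite !inE /update; case: eqP => [->|_] //.
    by rewrite bq andbF.
  by exists x; rewrite !inE ?xU // update_eq bq andbF.
have [lam' M'] := pm_drop M ncx (fun e y v exy bv ve =>
  nf (ex_intro _ e (ex_intro _ y (ex_intro _ v
    (And4 (pm_labD M ve) exy bv ve))))).
apply: IHn M'; apply: leq_trans le_n; apply: proper_card; apply/properP; split.
  by apply/subsetP => z; rewrite !inE => /andP[/andP[_ ->]].
by exists x; rewrite !inE ?xU ?eqxx.
Qed.

End Territory.

(** * Extending a partial model *)

Section Component.
Variables (G : sgraph) (B : {set G}) (r : G).

Definition component : {set G} := [set v in B | connect (within B) r v].

Lemma component_sub : component \subset B.
Proof. by apply/subsetP => v; rewrite inE => /andP[]. Qed.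

Lemma mem_component : r \in B -> r \in component.
Proof. by move=> rB; rewrite inE rB connect0. Qed.

Lemma component_connected : r \in B -> connected_in component.
Proof.
move=> rB; apply: (connected_from (u := r)) => z; rewrite inE => /andP[zB].
case/connectP=> p rp zE; have [->|zr] := eqVneq z r; first exact: connect0.
apply: path_within (mem_component rB) _ _.
- by apply: sub_path rp => a b /and3P[].
- move=> v vp; rewrite inE (path_connect rp) ?inE ?vp ?orbT // andbT.
  have /(nthP r)[i ip <-] := vp.
  by have /(pathP r)/(_ i ip)/and3P[] := rp.
- by have := mem_last r p; rewrite -zE inE (negPf zr).
Qed.

Lemma boundary_component v : boundary component v -> v \notin B.
Proof.
case/boundaryP=> vC [w]; rewrite inE => /andP[wB rw] wv.
apply: contra vC => vB; rewrite inE vB (connect_trans rw) //.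
by apply: connect1; rewrite /within wv wB.
Qed.

End Component.

Lemma boundary_sub (G : sgraph) (R R' : {set G}) v :
  R' \subset R -> v \notin R -> boundary R' v -> boundary R v.
Proof.
move=> sR vR /boundaryP[_ [r rR' rv]]; apply/boundaryP; split=> //.
by exists r => //; apply: (subsetP sR).
Qed.

Section Extension.
Variables (G : sgraph) (V E K : finType) (off : K -> nat).
Variable inc : E -> V -> V -> bool.
Hypothesis inc_sym : forall e x y, inc e x y = inc e y x.
Hypothesis inc_uniq : forall e x y x' y', inc e x y -> inc e x' y' ->
  (x' = x /\ y' = y) \/ (x' = y /\ y' = x).
Hypothesis inc_neq : forall e x y, inc e x y -> x != y.

Variables (R : {set G}) (s : E -> patrol G) (U : {set V}) (D : {set E}).
Variables (lam : G -> option (V + E)) (c : V -> G) (gd : V -> E).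
Hypothesis M : partial_model off inc R s U D lam c gd.

Variables (R' : {set G}) (e : E) (x y : V) (g : patrol G).
Hypotheses (sR : R' \subset R) (R'conn : connected_in R').
Hypotheses (eD : e \notin D) (exy : inc e x y) (g_ok : patrol_ok g R').

Let sub_ok i : patrol_ok (reassign s e g i) R'.
Proof.
apply: reassign_ok => // j _; exact: sub_patrol_ok sR (pm_patrol M j).
Qed.

(** No contact relies on the team of [e], since by [pm_guard_inc] it would belong to an end of [e].
    That team is thus free to guard the new one-vertex branch set. *)
Lemma pm_new_vertex a :
    x \notin U -> y \notin U -> a \in R -> a \notin R' ->
    (forall v, boundary R' v -> boundary R v \/ v = a) ->
    guards off g R' a ->
  partial_model off inc R' (reassign s e g) (x |: U) D
    (update lam a (Some (inl x))) (update c x a) (update gd x e).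
Proof.
move=> xU yU aR aR' bd ga.
pose lam' := update lam a (Some (inl x)).
have lamx v : lam v <> Some (inl x) by move/(pm_labU M); rewrite (negPf xU).
have lamE v l : lam v = Some l -> lam' v = Some l.
  move=> vl; rewrite /lam' update_neq //; apply: contraPneq vl => ->.
  by rewrite (pm_free M aR).
have lamV v z : z != x -> lam' v = Some (inl z) -> lam v = Some (inl z).
  move=> zx; rewrite /lam' /update; case: eqP => // _ [xz].
  by rewrite xz eqxx in zx.
have lamx' v : lam' v = Some (inl x) -> v = a.
  by rewrite /lam' /update; case: eqP => // _ /lamx.
have lamD v i : lam' v = Some (inr i) -> lam v = Some (inr i).
  by rewrite /lam' /update; case: eqP.
have bdR v l : lam v = Some l -> boundary R' v -> boundary R v.
  move=> vl; apply: boundary_sub sR _; apply: contraPN vl => vR.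
  by rewrite (pm_free M vR).
have gdU z : z \in U -> gd z != e.
  move=> zU; apply/eqP => gz; have [w] := pm_guard_inc M zU.
  rewrite gz => /(inc_uniq exy)[[zx _]|[zy _]].
    by rewrite -zx zU in xU.
  by rewrite -zy zU in yU.
have nx z : z \in x |: U -> z != x -> z \in U.
  by rewrite !inE => /orP[->|].
split=> //.
- move=> v vR'; rewrite update_neq ?(pm_free M) ?(subsetP sR) //.
  by apply: contraNneq aR' => <-.
- move=> v z; have [->|zx] := eqVneq z x; first by rewrite setU11.
  by move/(lamV _ _ zx)/(pm_labU M) => zU; rewrite inE zU orbT.
- by move=> v i /lamD; exact: (pm_labD M).
- move=> z zU; have [->|zx] := eqVneq z x; first by rewrite !update_eq.
  by rewrite (update_neq c) //; apply/lamE/(pm_contact M)/nx.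
- move=> z; have [->|zx] := eqVneq z x.
    by move=> u v; rewrite !inE => /eqP/lamx' -> /eqP/lamx' ->; exact: connect0.
  suff -> : core lam' z = core lam z by exact: (pm_core M).
  by apply/setP => v; rewrite !inE; apply/eqP/eqP => [/lamV|/lamE] //; exact.
- by move=> i u v iD iuv; rewrite inE (pm_DU M iD iuv) orbT.
- move=> i u v iD iuv; have [f [uf fE [u' [v' [uu vv uv]]]]] := pm_flex M iD iuv.
  exists f; split=> // [w|]; last by exists u', v'; split=> //; exact: lamE.
  by rewrite fE; apply/eqP/eqP => [/lamE|/lamD].
- move=> v bv; rewrite /update; case: eqP => // va.
  by have [bRv|//] := bd v bv; exact: (pm_bound M bRv).
- move=> v z bv; have [->|zx] := eqVneq z x.
    by move/lamx'; rewrite update_eq.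
  move/(lamV _ _ zx) => vz; rewrite update_neq //.
  exact: (pm_bound_core M (bdR _ _ vz bv) vz).
- move=> z zU; have [->|zx] := eqVneq z x; first by rewrite update_eq; exists y.
  by rewrite update_neq //; apply/(pm_guard_inc M)/nx.
- move=> z zU; have [->|zx] := eqVneq z x.
    by rewrite !update_eq /reassign eqxx.
  have {}zU := nx z zU zx; have cz := pm_contact M zU.
  rewrite !update_neq // /reassign (negPf (gdU z zU)) => bz.
  exact: sub_guards sR (pm_guard M zU (bdR _ _ cz bz)).
- move=> i u v iD iuv uU vU; have [ux|ux] := eqVneq u x.
    rewrite {1}ux update_eq => ei; rewrite -ei ux in iuv.
    have [[_ vy]|[xy _]] := inc_uniq exy iuv.
      by move: vU; rewrite vy !inE (negPf yU) orbF eq_sym (negPf (inc_neq exy)).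
    by have := inc_neq exy; rewrite -xy eqxx.
  have {}uU := nx u uU ux.
  rewrite update_neq // => gui.
  have [vx|vx] := eqVneq v x; last first.
    rewrite update_neq //; exact: (pm_guard_one M iD iuv uU (nx v vU vx) gui).
  by rewrite vx update_eq => ei; move: (gdU u uU); rewrite gui ei eqxx.
- move=> v i bv /lamD vi; have iD := pm_labD M vi.
  have ie : i != e by apply: contraNneq eD => <-.
  rewrite /reassign (negPf ie).
  exact: sub_guards sR (pm_guard_flex M (bdR _ _ vi bv) vi).
Qed.

(* If [y] has no branch set yet, the end [w] of the new path becomes one. *)
Lemma pm_new_edge f w :
    x \in U -> (y \in U /\ w = c y \/ y \notin U /\ w \in R) ->
    (y \in U -> gd y <> e) ->
    path (@adj G) (c x) (rcons f w) -> {subset f <= R} -> uniq f -> w \notin f ->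
    (forall v, v \in rcons f w -> v \notin R') ->
    (forall v, boundary R' v -> boundary R v \/ v \in rcons f w) ->
    (forall v, v \in c x :: f -> guards off g R' v) ->
    (y \notin U -> guards off g R' w) ->
  exists lam' c' gd',
    partial_model off inc R' (reassign s e g) (y |: U) (e |: D) lam' c' gd'.
Proof.
move=> xU Hw gdy xw fR uf wf fwR' bd gf gw.
have wR' : w \notin R' by apply: fwR'; rewrite mem_rcons mem_head.
have fR' v : v \in f -> v \notin R'.
  by move=> vf; apply: fwR'; rewrite mem_rcons inE vf orbT.
have lamw l : lam w = Some l -> l = inl y.
  by case: Hw => [[yU ->]|[_ /(pm_free M)->]] //; rewrite (pm_contact M yU) => -[].
have lamf v : v \in f -> lam v = None by move/fR/(pm_free M).
have lame v : lam v <> Some (inr e) by move/(pm_labD M); rewrite (negPf eD).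
pose lam' v := if v \in f then Some (inr e) else
  if v == w then Some (inl y) else lam v.
have lam'w : lam' w = Some (inl y) by rewrite /lam' (negPf wf) eqxx.
have lamE v l : lam v = Some l -> lam' v = Some l.
  rewrite /lam' => vl; case: ifP => [/lamf|_]; first by rewrite vl.
  by case: eqP => // vw; rewrite vw in vl; rewrite (lamw _ vl).
have lamV v z : z != y -> lam' v = Some (inl z) -> lam v = Some (inl z).
  move=> zy; rewrite /lam'; case: ifP => // _; case: eqP => // _ [yz].
  by rewrite yz eqxx in zy.
have lamy v : lam' v = Some (inl y) -> v = w \/ lam v = Some (inl y).
  by rewrite /lam'; case: ifP => // _; case: eqP; [left|right].
have lamD v i : i != e -> lam' v = Some (inr i) -> lam v = Some (inr i).
  move=> ie; rewrite /lam'; case: ifP => [_ [ei]|_]; last by case: eqP.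
  by rewrite ei eqxx in ie.
have lam'e v : lam' v = Some (inr e) -> v \in f.
  by rewrite /lam'; case: ifP => // _; case: eqP => // _ /lame.
have bdR v l : lam v = Some l -> boundary R' v -> boundary R v.
  move=> vl; apply: boundary_sub sR _; apply: contraPN vl => vR.
  by rewrite (pm_free M vR).
have ny z : z \in y |: U -> z != y -> z \in U by rewrite !inE => /orP[->|].
(* A new [y] is guarded by the team of [e] together with the path; an old one keeps its team. *)
exists lam', (update c y w), (update gd y (if y \in U then gd y else e)).
split=> //.
- move=> v vR'; rewrite /lam'; case: ifP => [/fR'|_]; first by rewrite vR'.
  case: eqP => [vw|_]; first by rewrite vw (negPf wR') in vR'.
  exact/(pm_free M)/(subsetP sR).
- move=> v z; have [->|zy] := eqVneq z y; first by rewrite setU11.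
  by move/(lamV _ _ zy)/(pm_labU M) => zU; rewrite inE zU orbT.
- move=> v i; have [->|ie] := eqVneq i e; first by rewrite setU11.
  by move/(lamD _ _ ie)/(pm_labD M) => iD; rewrite inE iD orbT.
- move=> z zU; have [->|zy] := eqVneq z y; first by rewrite update_eq.
  by rewrite update_neq //; apply/lamE/(pm_contact M)/ny.
- move=> z; have [->|zy] := eqVneq z y; last first.
    suff -> : core lam' z = core lam z by exact: (pm_core M).
    by apply/setP => v; rewrite !inE; apply/eqP/eqP => [/lamV|/lamE] //; exact.
  case: Hw => [[yU wy]|[yU wR]].
    suff -> : core lam' y = core lam y by exact: (pm_core M).
    apply/setP => v; rewrite !inE; apply/eqP/eqP => [/lamy[->|]|/lamE] //.
    by rewrite wy; exact: (pm_contact M).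
  have core_w v : v \in core lam' y -> v = w.
    rewrite inE => /eqP/lamy[//|/(pm_labU M)]; by rewrite (negPf yU).
  by move=> u v /core_w -> /core_w ->; exact: connect0.
- move=> i u v; have [->|ie] := eqVneq i e.
    by move=> _ /(inc_uniq exy)[[-> _]|[-> _]]; rewrite !inE ?xU ?eqxx ?orbT.
  by rewrite !inE (negPf ie) /= => iD iuv; rewrite (pm_DU M iD iuv) orbT.
- move=> i u v; have [-> _ euv|ie] := eqVneq i e.
    have fl : flex_path lam' e x y.
      exists f; split=> // [z|]; last first.
        by exists (c x), w; split=> //; apply/lamE/(pm_contact M).
      by apply/idP/eqP => [zf|/lam'e //]; rewrite /lam' zf.
    by have [[-> ->]|[-> ->]] := inc_uniq exy euv => //; apply: flex_path_sym.
  rewrite !inE (negPf ie) /= => iD iuv.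
  have [h [uh hE [u' [v' [uu vv uv]]]]] := pm_flex M iD iuv.
  exists h; split=> // [z|]; last by exists u', v'; split=> //; exact: lamE.
  by rewrite hE; apply/eqP/eqP => [/lamE|/(lamD _ _ ie)].
- move=> v bv; rewrite /lam'; case: ifP => // vf; case: eqP => // /eqP vw.
  have [bRv|] := bd v bv; first exact: (pm_bound M bRv).
  by rewrite mem_rcons inE (negPf vw) vf.
- move=> v z bv; have [->|zy] := eqVneq z y; last first.
    move/(lamV _ _ zy) => vz; rewrite update_neq //.
    exact: (pm_bound_core M (bdR _ _ vz bv) vz).
  rewrite update_eq => /lamy[//|vy].
  have -> := pm_bound_core M (bdR _ _ vy bv) vy.
  by case: Hw => [[_ ->]//|[yU]]; rewrite (pm_labU M vy) in yU.
- move=> z zU; have [->|zy] := eqVneq z y; last first.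
    by rewrite update_neq //; apply/(pm_guard_inc M)/ny.
  rewrite update_eq; case: ifP => [yU|_]; first exact: (pm_guard_inc M yU).
  by exists x; rewrite inc_sym.
- move=> z zU; have [->|zy] := eqVneq z y.
    rewrite !update_eq; case: ifPn => yU bw; last by rewrite /reassign eqxx; apply: gw.
    case: Hw => [[_ wy]|[]]; last by rewrite yU.
    rewrite wy in bw *; rewrite /reassign; case: eqP => [/(gdy yU)//|_].
    exact: sub_guards sR (pm_guard M yU (bdR _ _ (pm_contact M yU) bw)).
  have {}zU := ny z zU zy; rewrite !update_neq // /reassign => bz.
  case: eqP => [gz|_]; last first.
    exact: sub_guards sR (pm_guard M zU (bdR _ _ (pm_contact M zU) bz)).
  (* If [c z] relied on the team of [e], then [z] is [x], and the new patrol guards its start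
     [c x]. *)
  have [u] := pm_guard_inc M zU; rewrite gz => /(inc_uniq exy)[[-> _]|[zy' _]].
    by apply: gf; rewrite mem_head.
  by rewrite zy' eqxx in zy.
- move=> i u v; rewrite !inE negb_or => /andP[ie iD] iuv.
  have gdE z : (z == y) || (z \in U) ->
      update gd y (if y \in U then gd y else e) z = i -> z \in U /\ gd z = i.
    rewrite /update; case: eqP => [-> _|_ /= zU //].
    by case: ifP => // _ ei; rewrite ei eqxx in ie.
  move=> uU vU /(gdE u uU)[{}uU ui] /(gdE v vU)[{}vU vi].
  exact: (pm_guard_one M iD iuv uU vU ui vi).
- move=> v i bv; have [-> /lam'e vf|ie] := eqVneq i e.
    by rewrite /reassign eqxx; apply: gf; rewrite inE vf orbT.
  move/(lamD _ _ ie) => vi; rewrite /reassign (negPf ie).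
  exact: sub_guards sR (pm_guard_flex M (bdR _ _ vi bv) vi).
Qed.
End Extension.

(** * The pursuit: shrinking the territory *)

Section Chase.
Variables (G : sgraph) (V E K : finType) (off : K -> nat).
Hypotheses (off0 : exists k, off k = 0) (off2 : exists k, off k = 2).
Hypothesis off1 : bipartite G \/ exists k, off k = 1.
Variable inc : E -> V -> V -> bool.
Hypothesis inc_sym : forall e x y, inc e x y = inc e y x.
Hypothesis inc_uniq : forall e x y x' y', inc e x y -> inc e x' y' ->
  (x' = x /\ y' = y) \/ (x' = y /\ y' = x).
Hypothesis inc_neq : forall e x y, inc e x y -> x != y.
Hypothesis inc_ex : forall e, exists x y, inc e x y.
Hypothesis G_conn : connected_graph G.
Hypothesis no_model : forall (R : {set G}) s U lam c gd, R != set0 ->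
  partial_model off inc R s U setT lam c gd ->
  ~ (forall x, x \in U -> boundary R (c x)).

(** Induction on the size of [R]. The team of an unrealised edge [e] either founds a branch set on a
    vertex of [R], when no end of [e] has one, or advances along a geodesic from the contact of one
    end. The robber is then left with a smaller territory, and [pm_cleanup] restores contact. *)
Lemma model_trapped (R : {set G}) s U D lam c gd :
    partial_model off inc R s U D lam c gd ->
    (forall x, x \in U -> boundary R (c x)) ->
  forall r : G, r \in R -> trapped (positions off s r) r.
Proof.
have [n] := ubnP #|R|; elim: n R s U D lam c gd => // n IHn R s U D lam c gd.
rewrite ltnS => le_n M clean r0 r0R.
have [DT|] := boolP (D == setT).
  rewrite (eqP DT) in M; case: (no_model _ M clean).
  by apply/set0Pn; exists r0.
rewrite -subTset => /subsetPn[e _ eD].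
pose P v := exists z, [/\ z \in U, gd z = e, v = c z & guards off (s e) R v].
have cov : covered_except off s e R P.
  move=> v bv; case lv: (lam v) => [[z|i]|]; last by case: (pm_bound M bv).
    have zU := pm_labU M lv; have vz := pm_bound_core M bv lv; subst v.
    have gz := pm_guard M zU bv.
    have [ze|ze] := eqVneq (gd z) e; last by left; exists (gd z).
    by right; exists z; split=> //; rewrite -ze.
  left; exists i; last exact: (pm_guard_flex M bv lv).
  by apply: contraNneq eD => <-; exact: (pm_labD M lv).
(* Once the robber is off [Q], his new territory is his component of the rest of [R]. *)
have shrink (Q : {set G}) r : r \in R -> r \notin Q -> (exists2 q, q \in Q & q \in R) ->
    let R' := component (R :\: Q) r in
    [/\ R' \subset R, connected_in R', r \in R', #|R'| < n
      & forall v, v \in Q -> v \notin R'] /\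
    forall v, boundary R' v -> boundary R v \/ v \in Q.
  move=> rR rQ [q qQ qR] R'; have rB : r \in R :\: Q by rewrite inE rQ.
  have sR : R' \subset R by apply: subset_trans (component_sub _ _) (subsetDl _ _).
  have nQ v : v \in Q -> v \notin R'.
    move=> vQ; apply: contraL vQ => /(subsetP (component_sub _ _)).
    by rewrite inE => /andP[].
  split; first split=> //; try exact: component_connected; try exact: mem_component.
    apply: leq_trans le_n; apply: proper_card; apply/properP; split=> //.
    by exists q => //; apply: nQ.
  move=> v bv; have := boundary_component bv; rewrite inE negb_and negbK.
  case/orP=> [|vR]; [by right | left]; exact: boundary_sub sR vR bv.
have ok e' : e' != e -> patrol_ok (s e') R by move=> _; exact: (pm_patrol M).
have finish (R' : {set G}) s' U' D' lam' c' gd' (r : G) : r \in R' -> #|R'| < n ->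
    partial_model off inc R' s' U' D' lam' c' gd' ->
    trapped (positions off s' r) r.
  move=> rR' ltR' /(pm_cleanup inc_sym inc_uniq)[U1 [D1 [lam1 [c1 [gd1 [M1 clean1]]]]]].
  exact: (IHn _ _ _ _ _ _ _ ltR' M1 clean1).
have [x0 [y0 exy0]] := inc_ex e.
have [someU|/norP[x0U y0U]] := boolP ((x0 \in U) || (y0 \in U)); last first.
  have {}cov : covered_except off s e R (fun=> False).
    move=> v /cov[?|[z [zU ze _ _]]]; [by left | have [z'] := pm_guard_inc M zU].
    rewrite ze => /(inc_uniq exy0)[[zx _]|[zy _]].
      by rewrite zx (negPf x0U) in zU.
    by rewrite zy (negPf y0U) in zU.
  (* The route is the single vertex [r0], with the distance from it cut off at 1. *)
  pose d (v : G) : nat := v != r0.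
  have g_ok (B : {set G}) : patrol_ok (Patrol (fun=> r0) d 0 0) B.
    split=> //= [_|v v' _ _ _]; first by rewrite /step eqxx.
    by rewrite /d; case: (v' != r0).
  have adj_r0 v : v -- r0 -> exists k, d v + off k = 1.
    move=> vr0; have [k k0] := off0; exists k; rewrite k0 /d.
    by case: eqP vr0 => // ->; rewrite adj_irrefl.
  apply: (trapped_relocate (e := e) (v := r0) ok G_conn (pm_patrol M e) _ _ r0R).
    by move=> v /cov[]; [left|].
  apply: (trapped_advance ok off2 (q := fun=> r0) (d := d) (n := 0)) => //.
  - by move=> v /cov[]; [left|].
  - by move=> v [|//] _ _; apply: adj_r0.
  - by move=> [|//] _ _; rewrite /d eqxx.
  move=> r rR /(_ 0 isT) rr0; have [||] := shrink [set r0] r rR.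
  - by rewrite inE.
  - by exists r0; rewrite ?inE.
  case=> sR R'conn rR' ltR' nQ bd.
  apply: (finish _ _ _ _ _ _ _ _ rR' ltR').
  apply: (pm_new_vertex inc_uniq inc_neq M sR R'conn eD exy0 (g_ok _) x0U y0U r0R).
  - by apply: nQ; rewrite inE.
  - by move=> v /bd[|/set1P]; [left|right].
  - by exists 0; split=> // v _; apply: adj_r0.
(* By [pm_guard_one] the two ends of [e] do not both rely on its team; [x] is chosen so that the
   other end does not. *)
have {x0 y0 exy0 someU} [x [y [exy xU gdy]]] :
    exists x y, [/\ inc e x y, x \in U & y \in U -> gd y <> e].
  have [xU|xU] := boolP (x0 \in U); last first.
    exists y0, x0; rewrite inc_sym; split=> //; last by rewrite (negPf xU).
    by rewrite (negPf xU) in someU.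
  have [[yU gy]|gy] := pselect (y0 \in U /\ gd y0 = e).
    exists y0, x0; rewrite inc_sym; split=> // _ gx.
    exact: (pm_guard_one M eD exy0 xU yU gx gy).
  by exists x0, y0; split=> // yU gy'; apply: gy.
have /boundaryP[cxR [a aR acx]] := clean x xU.
(* If [y] has no branch set, any [b] in [R] would do: it will become that branch set. *)
have [b bR by_] : exists2 b, b \in R & (y \in U -> b -- c y).
  have [yU|] := boolP (y \in U); last by exists a.
  by have /boundaryP[_ [b bR bcy]] := clean y yU; exists b.
have cxa : c x -- a by rewrite adj_sym.
have [q [d [[cq qR uq lq] lip dq adjq]]] :=
  geodesic off0 off2 off1 (pm_conn M) cxR aR cxa bR.
have bq : b \in q.
  by have := mem_last (c x) q; rewrite lq inE => /orP[/eqP bc|//]; rewrite -bc bR in cxR.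
have [wk [wkS wk0 wkE]] := path_walk cq.
apply: (trapped_relocate (e := e) (v := c x) ok G_conn (pm_patrol M e) _ _ r0R).
  move=> v /cov[|[z [zU ze vz gv]]]; [by left | right].
  have [z'] := pm_guard_inc M zU; rewrite ze => /(inc_uniq exy)[[zx _]|[zy _]].
    by rewrite -zx -vz.
  by rewrite zy in zU ze; case: (gdy zU).
have g_ok : patrol_ok (Patrol wk d 0 (size q)) R by split.
rewrite -wk0; apply: (trapped_advance ok off2 g_ok).
- move=> v /cov[|[z [zU ze vz gv]]]; [by left | right].
  have [z'] := pm_guard_inc M zU; rewrite ze => /(inc_uniq exy)[[zx _]|[zy _]].
    by rewrite wk0 -zx.
  by rewrite zy in zU ze; case: (gdy zU).
- by move=> r j rR jq; rewrite wkE //; apply: adjq.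
- by move=> j jq; rewrite wkE // => _; apply: dq.
move=> r rR rwk.
have rq : r \notin q.
  apply/negP => /(nthP (c x))[j jq rj].
  by have := rwk j.+1 jq; rewrite wkE //= rj eqxx.
have [||] := shrink [set v in q] r rR; first by rewrite inE.
  by exists b; rewrite ?inE.
case=> sR R'conn rR' ltR' nQ bd; set R' := component _ _ in sR R'conn rR' ltR' nQ bd.
have gq v : v \in c x :: q -> guards off (Patrol wk d 0 (size q)) R' v.
  case/(nthP (c x)) => j jq <-; exists j; split=> //=; first by rewrite wkE.
  by move=> r' /(subsetP sR) r'R; apply: adjq.
have [lam1 [c1 [gd1]]] : exists lam' c' gd', partial_model off inc R'
    (reassign s e (Patrol wk d 0 (size q))) (y |: U) (e |: D) lam' c' gd'.
  have ext := pm_new_edge inc_sym inc_uniq M sR R'conn eD exy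
    (sub_patrol_ok sR g_ok).
  have [yU|yU] := boolP (y \in U).
    have cyR : c y \notin R by have /boundaryP[] := clean y yU.
    apply: (ext q (c y) xU) => //.
    - by left.
    - by rewrite rcons_path cq lq by_.
    - by apply: contra cyR => /qR.
    - move=> v; rewrite mem_rcons inE => /orP[/eqP->|vq].
        by apply: contra cyR => /(subsetP sR).
      by apply: nQ; rewrite inE.
    - move=> v /bd[|]; [by left | rewrite inE => vq; right].
      by rewrite mem_rcons inE vq orbT.
    - by rewrite yU.
  have [f qE] : exists f, q = rcons f b.
    case: (lastP q) lq bq => [//|f z]; rewrite last_rcons => -> _.
    by exists f.
  have [ub bf] : uniq f /\ b \notin f.
    by move: uq; rewrite qE rcons_uniq => /andP[].
  apply: (ext f b xU) => //.
  - by right.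
  - by rewrite -qE.
  - by move=> v vf; apply: qR; rewrite qE mem_rcons inE vf orbT.
  - by move=> v; rewrite -qE => vq; apply: nQ; rewrite inE.
  - by move=> v /bd; rewrite inE -qE.
  - move=> v; rewrite inE => vf; apply: gq.
    by rewrite inE qE mem_rcons inE orbCA vf orbT.
  - by move=> _; apply: gq; rewrite inE bq orbT.
exact: finish.
Qed.
End Chase.

(** * The bound *)

Section EdgeType.
Variable F : sgraph.

Definition edge := {e : {set F} | e \in edges F}.

Definition joins (e : edge) (x y : F) : bool := (x -- y) && (val e == [set x; y]).

Lemma joins_sym e x y : joins e x y = joins e y x.
Proof. by rewrite /joins adj_sym setUC. Qed.

Lemma joins_neq e x y : joins e x y -> x != y.
Proof. by case/andP=> xy _; apply: contraTneq xy => ->; rewrite adj_irrefl. Qed.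

Lemma joins_uniq e x y x' y' : joins e x y -> joins e x' y' ->
  (x' = x /\ y' = y) \/ (x' = y /\ y' = x).
Proof.
move=> /andP[_ /eqP exy] exy'; have xy' := joins_neq exy'.
case/andP: exy' => _; rewrite exy => /eqP E.
have : x' \in [set x; y] by rewrite E set21.
have : y' \in [set x; y] by rewrite E set22.
move: xy'; rewrite !inE => xy' /orP[]/eqP y'E /orP[]/eqP x'E.
- by rewrite x'E y'E eqxx in xy'.
- by right.
- by left.
- by rewrite x'E y'E eqxx in xy'.
Qed.

Lemma joins_ex e : exists x y, joins e x y.
Proof.
have := valP e; rewrite inE => /existsP[x /existsP[y /andP[xy eE]]].
by exists x, y; rewrite /joins xy.
Qed.

Lemma joins_adj x y : x -- y -> exists e, joins e x y.
Proof.
move=> xy; have xyE : [set x; y] \in edges F.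
  by rewrite inE; apply/existsP; exists x; apply/existsP; exists y; rewrite xy eqxx.
by exists (Sub [set x; y] xyE); rewrite /joins xy /= eqxx.
Qed.

End EdgeType.

Section MainBound.
Variables (H : sgraph) (h : H) (G : sgraph).
Let F := del_vertex h.
Hypothesis F_no_isolated : forall x : F, exists e y, @joins F e x y.

(** [R] is the bag of [h], joined to all others by their contacts, and the path of each edge goes to
    the bag of one chosen end. Without isolated vertices in [H - h], realising all edges gives every
    vertex a branch set. *)
Lemma full_model_minor (K : finType) (off : K -> nat) (R : {set G}) s U lam c gd :
    R != set0 -> partial_model off (@joins F) R s U setT lam c gd ->
    (forall x, x \in U -> boundary R (c x)) ->
  has_minor G H.
Proof.
case/set0Pn=> r rR M clean.
have {}clean x : boundary R (c x).
  apply: clean; have [e [y exy]] := F_no_isolated x.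
  by apply: (pm_DU M _ exy); rewrite inE.
have inU x : x \in U.
  have [e [y exy]] := F_no_isolated x.
  by apply: (pm_DU M _ exy); rewrite inE.
have /fin_all_exists[end_ endP] : forall e : edge F, exists x, exists y, joins e x y.
  exact: joins_ex.
pose phi v := if v \in R then Some h else
  match lam v with
  | Some (inl x) => Some (val x)
  | Some (inr e) => Some (val (end_ e))
  | None => None
  end.
have lamR v l : lam v = Some l -> v \in R = false.
  by move=> vl; apply/negP => /(pm_free M); rewrite vl.
have phi_core v x : lam v = Some (inl x) -> phi v = Some (val x).
  by move=> vx; rewrite /phi (lamR _ _ vx) vx.
have phi_flex v e : lam v = Some (inr e) -> phi v = Some (val (end_ e)).
  by move=> ve; rewrite /phi (lamR _ _ ve) ve.
have ne_h (x : F) : (val x == h) = false by apply/negbTE/(valP x).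
have phi_h v : phi v = Some h -> v \in R.
  rewrite /phi; case: ifP => // _; case: (lam v) => [[x|e]|] // [/eqP].
    by rewrite ne_h.
  by rewrite ne_h.
have phi_val v (x : F) : phi v = Some (val x) ->
    lam v = Some (inl x) \/ exists2 e, lam v = Some (inr e) & end_ e = x.
  rewrite /phi; case: ifP => [_ [/esym/eqP]|_]; first by rewrite ne_h.
  case: (lam v) => [[z|e]|] // [/val_inj zx]; first by left; rewrite zx.
  by right; exists e.
have edge_bags e (x y : F) : joins e x y -> end_ e = x ->
    exists a b, [/\ phi a = Some (val x), phi b = Some (val y) & a -- b].
  move=> exy ex; have [f [_ fE [u [v [ux vy uv]]]]] := pm_flex M (in_setT e) exy.
  exists (last u f), v; split; [|exact: phi_core|].
    have := mem_last u f; rewrite inE => /orP[/eqP->|]; first exact: phi_core.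
    by rewrite fE => /eqP/phi_flex ->; rewrite ex.
  by move: uv; rewrite rcons_path => /andP[].
have hP (x : H) : x = h \/ exists x' : F, x = val x'.
  by have [->|xh] := eqVneq x h; [left | right; exists (Sub x xh)].
apply: (minor_model_minor (phi := phi)); split.
- move=> x; have [->|[x' ->]] := hP x; first by exists r; rewrite /phi rR.
  by exists (c x'); apply/phi_core/(pm_contact M).
- move=> x; have [->|[x' ->]] := hP x.
    suff -> : bag phi h = R by exact: (pm_conn M).
    by apply/setP => v; rewrite inE; apply/eqP/idP => [/phi_h//|vR]; rewrite /phi vR.
  have sub : core lam x' \subset bag phi (val x').
    by apply/subsetP => v; rewrite !inE => /eqP/phi_core ->.
  have cc v : lam v = Some (inl x') -> connect (within (bag phi (val x'))) (c x') v.
    move=> vx; apply: connected_within_sub sub _.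
    by apply: (pm_core M); rewrite inE ?vx ?(pm_contact M) ?inE.
  apply: (connected_from (u := c x')) => z; rewrite inE.
  case/eqP/phi_val=> [/cc//|[e ze ex]].
  have [y exy] := endP e; rewrite ex in exy.
  have [f [_ fE [u [v [ux vy uv]]]]] := pm_flex M (in_setT e) exy.
  apply: connect_trans (cc u ux) _; apply: (path_within (p := f)).
  + by move: uv; rewrite rcons_path => /andP[].
  + by rewrite inE (phi_core _ _ ux).
  + by move=> w; rewrite fE inE => /eqP/phi_flex ->; rewrite ex.
  + by rewrite fE ze.
- move=> x y; have [->|[x' ->]] := hP x; have [->|[y' ->]] := hP y.
  + by rewrite adj_irrefl.
  + have /boundaryP[_ [a aR ay]] := clean y'.
    exists a, (c y'); split=> //; first by rewrite /phi aR.
    exact/phi_core/(pm_contact M).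
  + have /boundaryP[_ [a aR ax]] := clean x'.
    exists (c x'), a; split; [exact/phi_core/(pm_contact M)|by rewrite /phi aR|].
    by rewrite adj_sym.
  + move=> xy; have [e exy] : exists e, @joins F e x' y' by exact: joins_adj.
    have [z ez] := endP e.
    have [[ex _]|[ey _]] := joins_uniq exy ez; first exact: edge_bags ex.
    have [|a [b [ay bx ab]]] := edge_bags e y' x' _ ey; first by rewrite joins_sym.
    by exists b, a; rewrite adj_sym.
Qed.

Hypotheses (G_connected : connected_graph G) (G_no_minor : ~ has_minor G H).

(** The pursuit starts from the empty partial model: the territory is all of [G] and has no
    boundary. *)
Lemma surrounding_bound m (off : 'I_m -> nat) :
    (exists k, off k = 0) -> (exists k, off k = 2) ->
    (bipartite G \/ exists k, off k = 1) ->
  surrounding_cop_number G <= m * #|edges F|.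
Proof.
move=> off0 off2 off1.
have bound n : cops_win G n -> surrounding_cop_number G <= n.
  rewrite /surrounding_cop_number; case: ex_minnP => k _ min_k win.
  exact/min_k/asboolP.
have [v0|G0] := pickP (pred_of_simpl (@predT G)); last first.
  apply: leq_trans (leq0n _); apply: bound.
  by apply: (trapped_cops_win (c := of_void G)); rewrite ?card_void // => r; have := G0 r.
move=> _; apply: bound.
have [gd gdP] : exists gd : F -> edge F, forall x, exists y, joins (gd x) x y.
  exact: fin_all_exists F_no_isolated.
have M : partial_model off (@joins F) setT (fun=> stand v0) set0 set0
    (fun=> None) (fun=> v0) gd.
  have nb (v : G) : boundary setT v = false by rewrite /boundary inE.
  split=> //; try by [move=> ?; rewrite inE | move=> ? ? ?; rewrite inE].
  - move=> u v _ _; apply: connect_sub (G_connected u v) => a b ab.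
    by apply: connect1; rewrite /within ab !inE.
  - by move=> e; exact: stand_ok.
  - by move=> v; rewrite nb.
  - by move=> e x y _ _; rewrite inE.
have W := trapped_cops_win (c := positions off (fun=> stand v0 : patrol G) v0).
apply: (W (edge F)); first by rewrite card_prod card_sig card_ord mulnC.
(* Standing teams ignore the robber, so one initial placement serves every [r]. *)
move=> r; rewrite (_ : positions _ _ v0 = positions off (fun=> stand v0) r) //.
apply: (model_trapped off0 off2 off1 (@joins_sym F) (@joins_uniq F) (@joins_neq F)
  (@joins_ex F) G_connected _ M).
- by move=> R s U lam c gd' R0 M' clean; apply/G_no_minor/(full_model_minor R0 M' clean).
- by move=> x; rewrite inE.
- by rewrite inE.
Qed.

End MainBound.

Theorem theorem6p3 (H : sgraph) (h : H)
    (H_no_isolated : forall x : H, x != h -> degree x != 0)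
    (h_no_leaf : forall x : H, h -- x -> degree x != 1)
    (G : sgraph) (G_connected : connected_graph G)
    (G_no_H_minor : ~ has_minor G H) :
  surrounding_cop_number G <= 3 * #|edges (del_vertex h)| /\
  (bipartite G -> surrounding_cop_number G <= 2 * #|edges (del_vertex h)|).
Proof.
have F_no_isolated (x : del_vertex h) : exists e y, @joins (del_vertex h) e x y.
  (* Otherwise [h] would be the only neighbour of [x], and [x] a neighbour of [h] of degree one. *)
  suff [y yh xy] : exists2 y : H, y != h & val x -- y.
    by have [e exy] := @joins_adj (del_vertex h) x (Sub y yh) xy; exists e, (Sub y yh).
  apply: contrapT => only_h.
  have nbr y : val x -- y -> y = h.
    by move=> xy; apply: contrapT => /eqP yh; apply: only_h; exists y.
  have := H_no_isolated _ (valP x); rewrite -lt0n => /card_gt0P[y].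
  rewrite inE => xy; have yh := nbr y xy; rewrite yh in xy.
  have hx : h -- val x by rewrite adj_sym.
  case/negP: (h_no_leaf _ hx).
  rewrite /degree (_ : [set y | _] = [set h]) ?cards1 //.
  by apply/setP => z; rewrite !inE; apply/idP/eqP => [/nbr|->].
split=> [|bip].
  apply: (surrounding_bound F_no_isolated G_connected G_no_H_minor (off := val)).
  - by exists (@Ordinal 3 0 isT).
  - by exists (@Ordinal 3 2 isT).
  - by right; exists (@Ordinal 3 1 isT).
(* Two cops per team, with the offsets 0 and 2. *)
apply: (surrounding_bound F_no_isolated G_connected G_no_H_minor
  (off := fun k : 'I_2 => k.*2)).
- by exists (@Ordinal 2 0 isT).
- by exists (@Ordinal 2 1 isT).
- by left.
Qed.
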